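(* Let $m\ge1$ be an integer, $\underline a\in\mathbb{C}^m$ and $p=(1+4a_m)^{1/2}$. Then $$\mathrm{Tr}\big(\mathfrak{S}_0(\underline a)\mathfrak{S}_1(\underline a)\cdots\mathfrak{S}_{m-1}(\underline a)\big)=-2\cos(\pi p),$$ where $\mathrm{Tr}$ is the trace.
   Context: $(\mathfrak{E}_m)$ is the equation $\Phi''(x)=\frac{P_m(x,\underline a)}{x^2}\Phi(x)$, $P_m(x,\underline a)=x^m+a_1x^{m-1}+\cdots+a_m$, $\underline a\in\mathbb{C}^m$; $x$ lies on the universal covering of $\mathbb{C}^\star$. $\omega=e^{2i\pi/m}$, $\omega^c:=e^{2i\pi c/m}$, $\lambda.\underline a:=(\lambda a_1,\dots,\lambda^ma_m)$. Define $b_{\frac m2-k}(\underline a)$ by $\frac{\sqrt{P_m(x,\underline a)}}{x}=x^{\frac m2-1}+\sum_{k\ge1}b_{\frac m2-k}(\underline a)x^{\frac m2-k-1}$ at infinity; $r(\underline a)=\frac12-\frac m4$ ($m$ odd), $r(\underline a)=\frac12-\frac m4-b_0(\underline a)$ ($m$ even); $S(x,\underline a)=\frac2mx^{\frac m2}+\sum_{1\le k<m/2}\frac{b_{\frac m2-k}(\underline a)}{\frac m2-k}x^{\frac m2-k}$. $\Phi_0(x,\underline a)$ is the unique solution of $(\mathfrak{E}_m)$ asymptotic at infinity to $x^{r(\underline a)}e^{-S(x,\underline a)}\phi_0$ ($\phi_0$ a formal series in $x^{-1/2}$, resp. $x^{-1}$ for $m$ even, with constant term $1$) in every strict sub-sector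 of $\{|\arg x|<3\pi/m\}$, locally uniformly in $\underline a$; it extends analytically to the universal covering of $\mathbb{C}^\star$ and is entire in $\underline a$. $\Phi_k(x,\underline a)=\Phi_0(\omega^kx,\omega^k.\underline a)$, and the Stokes-Sibuya connection matrix $\mathfrak{S}_k(\underline a)=\begin{pmatrix}C_k(\underline a)&\widetilde C_k(\underline a)\\1&0\end{pmatrix}$ is defined by $\begin{pmatrix}\Phi_{k-1}\\\Phi_k\end{pmatrix}=\mathfrak{S}_k(\underline a)\begin{pmatrix}\Phi_k\\\Phi_{k+1}\end{pmatrix}$. *)

(* Defs.v *)
From HB Require Import structures.
From mathcomp Require Import all_boot all_order all_algebra.
From mathcomp Require Import complex.
From mathcomp Require Import all_classical all_reals all_analysis.

Set Implicit Arguments.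
Unset Strict Implicit.
Unset Printing Implicit Defensive.

Import Order.TTheory GRing.Theory Num.Theory.
Import numFieldNormedType.Exports.

Local Open Scope classical_set_scope.
Local Open Scope ring_scope.
Local Open Scope complex_scope.

(* R[i] has no canonical topology of its own; packed as a numFieldType it gets
   the one induced by its norm, together with the associated normed module
   structures (also on 'rV[Cx R]_m). *)
Definition Cx (R : realType) : numFieldType := R[i].

Definition ofR (R : realType) (x : R) : Cx R := x%:C.
Definition Ci (R : realType) : Cx R := 'i.
Definition ReC (R : realType) (z : Cx R) : R := complex.Re z.
Definition ImC (R : realType) (z : Cx R) : R := complex.Im z.

Definition expC (R : realType) (z : Cx R) : Cx R :=
  ofR (expR (ReC z)) * (ofR (cos (ImC z)) + Ci R * ofR (sin (ImC z))).

Definition cosC (R : realType) (z : Cx R) : Cx R :=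
  (expC (Ci R * z) + expC (- (Ci R * z))) / 2.

(* A point x of the universal covering of C^* is represented by its logarithm
   t: x = e^t, |x| = e^(Re t), arg x = Im t.  Functions holomorphic on the
   covering are exactly the entire functions of t. *)

(* x ^ s, where x = e^t *)
Definition cpow (R : realType) (t s : Cx R) : Cx R := expC (s * t).

(* d/dx, where x = e^t *)
Definition Dx (R : realType) (F : Cx R -> Cx R) : Cx R -> Cx R :=
  fun t => expC (- t) * derive1 F t.

(* The entry a 0 i is the coefficient a_(i+1). *)
Definition Pm (R : realType) (m : nat) (a : 'rV[Cx R]_m) : {poly Cx R} :=
  'X^m + \sum_(i < m) a 0 i *: 'X^(m - i.+1).

Definition is_solution (R : realType) (m : nat) (a : 'rV[Cx R]_m)
    (F : Cx R -> Cx R) : Prop :=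
  forall t : Cx R,
    [/\ derivable F t 1, derivable (Dx F) t 1
      & Dx (Dx F) t = (Pm a).[expC t] / expC t ^+ 2 * F t].

Definition omega (R : realType) (m : nat) (c : Cx R) : Cx R :=
  expC (2 * Ci R * ofR pi * c / m%:R).

Definition rescale (R : realType) (m : nat) (lam : Cx R) (a : 'rV[Cx R]_m) :
  'rV[Cx R]_m := \row_(i < m) (lam ^+ i.+1 * a 0 i).

(* b k stands for b_(m/2 - k).  The expansion of sqrt(P_m) / x converges for
   |x| large; b 0 = 1 is the coefficient of the leading term x^(m/2 - 1), which
   selects the branch of the square root y of P_m. *)
Definition sqrt_expansion (R : realType) (m : nat) (a : 'rV[Cx R]_m)
    (b : nat -> Cx R) : Prop :=
  b 0%N = 1 /\
  exists M : R, forall t : Cx R, M < ReC t ->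
    exists y : Cx R, y ^+ 2 = (Pm a).[expC t] /\
      series (fun k => b k * cpow t (m%:R / 2 - k%:R - 1)) @ \oo
        --> y / expC t.

(* r(a) *)
Definition exponent (R : realType) (m : nat) (b : nat -> Cx R) : Cx R :=
  1 / 2 - m%:R / 4 - (if odd m then 0 else b m./2).

(* S(x, a) *)
Definition Sm (R : realType) (m : nat) (b : nat -> Cx R) (t : Cx R) : Cx R :=
  2 / m%:R * cpow t (m%:R / 2) +
  \sum_(1 <= k < m | (k.*2 < m)%N)
     b k / (m%:R / 2 - k%:R) * cpow t (m%:R / 2 - k%:R).

(* The formal series phi_0 = sum_n (c n a) x^(- n * step) is in powers of
   x^(-1/2) for m odd, of x^(-1) for m even. *)
Definition step (R : realType) (m : nat) : Cx R := if odd m then 1 / 2 else 1.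

(* Every strict sub-sector of |arg x| < 3 pi / m lies in some |arg x| <= theta
   with theta < 3 pi / m; the asymptotic expansion is in the sense of Poincare,
   with the bounds on the remainders uniform for a near any given a0. *)
Record is_Phi0 (R : realType) (m : nat) (b : 'rV[Cx R]_m -> nat -> Cx R)
    (Phi0 : Cx R -> 'rV[Cx R]_m -> Cx R) : Prop := {
  Phi0_solution : forall a, is_solution a (Phi0 ^~ a);
  Phi0_asymptotic : exists c : nat -> 'rV[Cx R]_m -> Cx R,
    (forall a, c 0%N a = 1) /\
    forall (a0 : 'rV[Cx R]_m) (theta : R) (N : nat), theta < 3 * pi / m%:R ->
      exists K X : R, \forall a \near a0,
        forall t : Cx R, X < ReC t -> `|ImC t| <= theta ->
          `| Phi0 t a / (cpow t (exponent m (b a)) * expC (- Sm m (b a) t))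
             - \sum_(n < N) c n a * cpow t (- (n%:R * step R m)) |
          <= ofR K * `| cpow t (- (N%:R * step R m)) |;
  Phi0_entire : forall t a, differentiable (Phi0 t) a
}.

(* Multiplication of x by omega^k on the covering adds 2 i pi k / m to t. *)
Definition Phi (R : realType) (m : nat)
    (Phi0 : Cx R -> 'rV[Cx R]_m -> Cx R) (k : int)
    (t : Cx R) (a : 'rV[Cx R]_m) : Cx R :=
  Phi0 (t + 2 * Ci R * ofR pi * k%:~R / m%:R) (rescale (omega m k%:~R) a).

Definition col2 (R : realType) (x y : Cx R) : 'cV[Cx R]_2 :=
  \col_(i < 2) (if i == 0 then x else y).

Definition stokes_mx (R : realType) (c ct : Cx R) : 'M[Cx R]_2 :=
  \matrix_(i < 2, j < 2)
    (if i == 0 then (if j == 0 then c else ct) else (if j == 0 then 1 else 0)).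

Definition is_connection (R : realType) (m : nat)
    (Phi0 : Cx R -> 'rV[Cx R]_m -> Cx R)
    (C Ct : int -> 'rV[Cx R]_m -> Cx R) : Prop :=
  forall (k : int) (a : 'rV[Cx R]_m) (t : Cx R),
    col2 (Phi Phi0 (k - 1) t a) (Phi Phi0 k t a) =
    stokes_mx (C k a) (Ct k a)
      *m col2 (Phi Phi0 k t a) (Phi Phi0 (k + 1) t a).

(* Main.v *)
Require Import Defs.
From mathcomp Require Import all_boot all_order all_algebra.
From mathcomp Require Import complex ring lra.
From mathcomp Require Import all_classical all_reals all_analysis.

Import Order.TTheory GRing.Theory Num.Theory.
Import numFieldNormedType.Exports.
Local Open Scope ring_scope.

(** Write S = S_0 S_1 ... S_(m-1) and t = log x.  Multiplying the defining
relations of the connection matrices gives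
  (Phi_(-1), Phi_0)(t) = S (Phi_(m-1), Phi_m)(t)
                       = S (Phi_(-1), Phi_0)(t + 2 i pi),
because x |-> omega^m x is one full turn and omega^m acts trivially on the
coefficients, the equation itself being invariant under the rotation
(connection_prod, Phi_turn, potential_rescale).  If Phi_(-1) and Phi_0 are
linearly independent, S is therefore conjugate to the inverse of the monodromy
of the equation around x = 0, a regular singularity with exponents s, 1 - s
where s (s - 1) = a_m, that is s = (1 + p) / 2.  The monodromy has determinant 1
and eigenvalue e^(2 i pi s), whence the trace
  e^(2 i pi s) + e^(- 2 i pi s) = - 2 cos (pi p).

Independence (Phi_lin_indep).  On the positive real axis Phi_0 decays like
exp (- (2/m) x^(m/2)), whereas Phi_(-1), which is Phi_0 evaluated at argument
- 2 pi / m, still inside the sector |arg x| < 3 pi / m, grows like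
exp (+ (2/m) x^(m/2)) (Phi0_growth).  A vanishing Wronskian would make them proportional on a half
line, which is absurd.

The eigenvalue (connection_trace).  No local solution at 0 is constructed, so
the resonant values of p need no special care.  With respect to t the equation
reads f'' = f' + q f with q (t) = P_m (e^t, a), and q (t) = a_m + O (e^(Re t))
as Re t -> - oo.  The combination h = f' - (1 - s) f satisfies
h' = s h + (q - s (s - 1)) f, so that over the vertical segment from t = - N to
t = - N + 2 i pi it is multiplied by l = e^(2 i pi s) up to an error O (e^(- N)),
provided that the solution has initial data of size 1 at - N: its growth along
the segment is bounded independently of N (energy_growth, turn_estimate).  The
matrix of the monodromy in the basis of solutions normalised at - N thus has an
approximate eigenvector for l, common to all N, and l^2 - l tr + 1 = O (e^(- N))
(trace_defect).  As tr does not depend on N, l^2 - l tr + 1 = 0.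

Only one-variable real calculus enters: complex differentiable functions are
restricted to real lines, where their real and imaginary parts obey the mean
value theorem. *)

Set Implicit Arguments.
Unset Strict Implicit.

(** * Complex numbers, modulus and exponential *)

Section ComplexNumbers.
Context {R : realType}.
Implicit Types (z w : Cx R) (x y : R).

(** The norm of the normed field Cx R takes its values in Cx R itself; this is the
same modulus, with real values. *)
Definition modC z : R := Normc.normc z.

Lemma normCx z : `|z| = ofR (modC z).
Proof. by []. Qed.

Lemma ReCD z w : ReC (z + w) = ReC z + ReC w.
Proof. by case: z w => [a b] [c d]. Qed.
Lemma ImCD z w : ImC (z + w) = ImC z + ImC w.
Proof. by case: z w => [a b] [c d]. Qed.
Lemma ReCN z : ReC (- z) = - ReC z.
Proof. by case: z => [a b]. Qed.
Lemma ImCN z : ImC (- z) = - ImC z.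
Proof. by case: z => [a b]. Qed.
Lemma ReCM z w : ReC (z * w) = ReC z * ReC w - ImC z * ImC w.
Proof. by case: z w => [a b] [c d]. Qed.
Lemma ImCM z w : ImC (z * w) = ReC z * ImC w + ImC z * ReC w.
Proof. by case: z w => [a b] [c d]. Qed.
Lemma ReCofR x : ReC (ofR x) = x. Proof. by []. Qed.
Lemma ImCofR x : ImC (ofR x) = 0. Proof. by []. Qed.
Lemma ReCi : ReC (Ci R) = 0. Proof. by []. Qed.
Lemma ImCi : ImC (Ci R) = 1. Proof. by []. Qed.
Lemma ReC0 : ReC (0 : Cx R) = 0. Proof. by []. Qed.
Lemma ImC0 : ImC (0 : Cx R) = 0. Proof. by []. Qed.
Lemma ReC1 : ReC (1 : Cx R) = 1. Proof. by []. Qed.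
Lemma ImC1 : ImC (1 : Cx R) = 0. Proof. by []. Qed.

Definition ReImE := (ReCD, ImCD, ReCN, ImCN, ReCM, ImCM, ReCofR, ImCofR, ReCi,
  ImCi, ReC0, ImC0, ReC1, ImC1).

Lemma CxP z w : ReC z = ReC w -> ImC z = ImC w -> z = w.
Proof. by case: z w => [a b] [c d] /= -> ->. Qed.

Lemma ofRD x y : ofR (x + y) = ofR x + ofR y.
Proof. by apply: CxP; rewrite !ReImE ?addr0. Qed.
Lemma ofRN x : ofR (- x) = - ofR x.
Proof. by apply: CxP; rewrite !ReImE ?oppr0. Qed.
Lemma ofRM x y : ofR (x * y) = ofR x * ofR y.
Proof. by apply: CxP; rewrite !ReImE; ring. Qed.
Lemma ofR0 : ofR (0 : R) = 0. Proof. by []. Qed.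
Lemma ofR1 : ofR (1 : R) = 1. Proof. by []. Qed.
Lemma ofR_nat n : ofR (n%:R : R) = n%:R.
Proof. by elim: n => // n IH; rewrite -!natr1 ofRD IH. Qed.
Lemma ofR_inv x : ofR x^-1 = (ofR x)^-1.
Proof.
have [->|x0] := eqVneq x 0; first by rewrite invr0 ofR0 invr0.
have ox0 : ofR x != 0 by apply: contraNneq x0 => /(congr1 (@ReC R)) /= ->.
by apply: (mulfI ox0); rewrite -ofRM !mulfV.
Qed.

Lemma modC_ge0 z : 0 <= modC z.
Proof. by case: z => a b; exact: sqrtr_ge0. Qed.
Lemma modCM z w : modC (z * w) = modC z * modC w.
Proof. exact: Normc.normcM. Qed.
Lemma modCD z w : modC (z + w) <= modC z + modC w.
Proof. exact: le_normcD. Qed.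
Lemma modCN z : modC (- z) = modC z.
Proof. exact: normcN. Qed.
Lemma modCB z w : modC (z - w) <= modC z + modC w.
Proof. by rewrite -(modCN w) modCD. Qed.
Lemma modC0 : modC 0 = 0.
Proof. exact: Normc.normc0. Qed.
Lemma modC1 : modC 1 = 1.
Proof. exact: Normc.normc1. Qed.
Lemma modC_eq0 z : modC z = 0 -> z = 0.
Proof. exact: Normc.eq0_normc. Qed.
Lemma modC_sqr z : modC z ^+ 2 = ReC z ^+ 2 + ImC z ^+ 2.
Proof. by case: z => a b; rewrite sqr_sqrtr // addr_ge0 // sqr_ge0. Qed.
Lemma modC_ofR x : modC (ofR x) = `|x|.
Proof. by rewrite /modC /= expr0n addr0 sqrtr_sqr. Qed.
Lemma modC_Ci : modC (Ci R) = 1.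
Proof. by rewrite /modC /= expr0n add0r expr1n sqrtr1. Qed.

Lemma ReC_le z : `|ReC z| <= modC z.
Proof.
rewrite -(ler_pXn2r (n:=2)) ?nnegrE ?modC_ge0 // modC_sqr real_normK ?num_real //.
by rewrite lerDl sqr_ge0.
Qed.
Lemma ImC_le z : `|ImC z| <= modC z.
Proof.
rewrite -(ler_pXn2r (n:=2)) ?nnegrE ?modC_ge0 // modC_sqr real_normK ?num_real //.
by rewrite lerDr sqr_ge0.
Qed.
Lemma modC_le z : modC z <= `|ReC z| + `|ImC z|.
Proof.
rewrite -(ler_pXn2r (n:=2)) ?nnegrE ?modC_ge0 ?addr_ge0 //.
by rewrite modC_sqr sqrrD !real_normK ?num_real // lerD2r lerDl mulrn_wge0 // mulr_ge0.
Qed.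

Lemma ReC_expC z : ReC (expC z) = expR (ReC z) * cos (ImC z).
Proof. by rewrite /expC !ReImE; ring. Qed.
Lemma ImC_expC z : ImC (expC z) = expR (ReC z) * sin (ImC z).
Proof. by rewrite /expC !ReImE; ring. Qed.

Lemma expCD z w : expC (z + w) = expC z * expC w.
Proof.
by apply: CxP; rewrite /expC !ReImE expRD cosD sinD; ring.
Qed.
Lemma expC0 : expC (0 : Cx R) = 1.
Proof. by apply: CxP; rewrite /expC !ReImE expR0 cos0 sin0; ring. Qed.
Lemma expCN z : expC (- z) * expC z = 1.
Proof. by rewrite -expCD addNr expC0. Qed.
Lemma expC_neq0 z : expC z != 0.
Proof.
by apply: contraTneq isT => h; move: (expCN z) => /eqP; rewrite h mulr0 eq_sym oner_eq0.
Qed.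
Lemma expCNV z : expC (- z) = (expC z)^-1.
Proof. by apply: (mulIf (expC_neq0 z)); rewrite expCN mulVf ?expC_neq0. Qed.
Lemma expCMn z n : expC (n%:R * z) = expC z ^+ n.
Proof.
by elim: n => [|n IH]; rewrite ?mul0r ?expC0 // -natr1 mulrDl mul1r expCD IH exprSr.
Qed.
Lemma expC_2pi : expC (2 * Ci R * ofR pi) = 1.
Proof.
have -> : 2 * Ci R * ofR pi = Ci R * ofR (pi *+ 2).
  by rewrite mulr2n ofRD; ring.
apply: CxP; rewrite /expC !ReImE.
  by rewrite !(mul0r, mul1r, mulr0, subr0, subrr, addr0, add0r) cos2pi expR0; ring.
by rewrite !(mul0r, mul1r, mulr0, subr0, subrr, addr0, add0r) sin2pi expR0; ring.
Qed.
Lemma expC_pi : expC (Ci R * ofR pi) = -1.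
Proof.
by apply: CxP; rewrite /expC !ReImE !(mul0r, mul1r, mulr0, subr0, subrr, addr0, add0r)
  ?cospi ?sinpi expR0 ?mulr0 ?mul1r ?oppr0.
Qed.
Lemma modC_expC z : modC (expC z) = expR (ReC z).
Proof.
apply/eqP; rewrite -(eqrXn2 (n:=2)) ?modC_ge0 ?expR_ge0 //; apply/eqP.
rewrite modC_sqr /expC !ReImE.
have h := cos2Dsin2 (ImC z).
transitivity (expR (ReC z) ^+ 2 * (cos (ImC z) ^+ 2 + sin (ImC z) ^+ 2)); first by ring.
by rewrite h mulr1.
Qed.

End ComplexNumbers.

(** * Curves in the complex plane *)

Section Curves.
Local Open Scope classical_set_scope.
Context {R : realType}.
Implicit Types (z w : Cx R) (s x y : R).

(** A first order expansion with an error bound, rather than a limit of quotients,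
is what passes from complex increments to real ones. *)
Lemma is_derive_of_error (phi : R -> R) x d :
  (forall e : R, 0 < e -> exists2 r : R, 0 < r &
     forall h : R, `|h| < r -> `|phi (x + h) - phi x - h * d| <= e * `|h|) ->
  is_derive x 1 phi d.
Proof.
move=> H.
have lim : h^-1 *: ((phi \o shift x) (h *: 1) - phi x) @[h --> 0^'] --> d.
  apply/cvgrPdist_le => e e0; have [r r0 Hr] := H e e0.
  apply/nbhs_ballP; exists r => //= h; rewrite /ball /= sub0r normrN => hr h0.
  have h0' : 0 < `|h| by rewrite normr_gt0.
  rewrite -(ler_pM2l h0') (mulrC _ e); apply: le_trans (Hr h hr).
  rewrite -normrM mulrBr /GRing.scale /= mulr1 mulrA mulfV // mul1r distrC.
  by rewrite (addrC h).
apply: DeriveDef; first by apply/cvg_ex; exists d.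
exact: cvg_lim.
Qed.

(** Derivatives of plane curves are taken componentwise, which gives access to the
real mean value theorem. *)
Definition cderiv (g : R -> Cx R) s (d : Cx R) : Prop :=
  is_derive s 1 (fun u => ReC (g u)) (ReC d) /\
  is_derive s 1 (fun u => ImC (g u)) (ImC d).

Lemma cderiv_eq g s d d' : cderiv g s d -> d = d' -> cderiv g s d'.
Proof. by move=> ? <-. Qed.

Lemma cderiv_cst c s : cderiv (fun=> c) s 0.
Proof. by split; exact: is_derive_cst. Qed.

Lemma is_derive_ext (f g : R -> R) x d d' :
  is_derive x 1 f d -> f =1 g -> d = d' -> is_derive x 1 g d'.
Proof. by move=> h /funext <- <-. Qed.

Lemma cderivD g1 g2 s d1 d2 : cderiv g1 s d1 -> cderiv g2 s d2 ->
  cderiv (fun u => g1 u + g2 u) s (d1 + d2).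
Proof.
move=> [r1 i1] [r2 i2]; split.
  by apply: (is_derive_ext (is_deriveD r1 r2)) => [u|]; rewrite ReCD.
by apply: (is_derive_ext (is_deriveD i1 i2)) => [u|]; rewrite ImCD.
Qed.

Lemma cderivM g1 g2 s d1 d2 : cderiv g1 s d1 -> cderiv g2 s d2 ->
  cderiv (fun u => g1 u * g2 u) s (d1 * g2 s + g1 s * d2).
Proof.
move=> [r1 i1] [r2 i2]; split.
  apply: (is_derive_ext (is_deriveB (is_deriveM r1 r2) (is_deriveM i1 i2))) => [u|].
    by rewrite ReCM.
  by rewrite !ReImE /GRing.scale /=; ring.
apply: (is_derive_ext (is_deriveD (is_deriveM r1 i2) (is_deriveM i1 r2))) => [u|].
  by rewrite ImCM.
by rewrite !ReImE /GRing.scale /=; ring.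
Qed.

Lemma cderiv_unique g s d d' : cderiv g s d -> cderiv g s d' -> d = d'.
Proof.
move=> [r1 i1] [r2 i2].
by apply: CxP; [rewrite -(@derive_val _ _ _ _ _ _ _ r1) -(@derive_val _ _ _ _ _ _ _ r2)
  | rewrite -(@derive_val _ _ _ _ _ _ _ i1) -(@derive_val _ _ _ _ _ _ _ i2)].
Qed.

Lemma cderiv_line z w s : cderiv (fun u => z + ofR u * w) s w.
Proof.
have lin (c d : R) : is_derive s 1 (fun u => c + u * d) d.
  apply: (is_derive_ext (is_deriveD (is_derive_cst c s 1)
    (is_deriveM (is_derive_id s 1) (is_derive_cst d s 1)))) => [u|] //.
  by rewrite /GRing.scale /=; ring.
split.
  by apply: (is_derive_ext (lin (ReC z) (ReC w))) => // u; rewrite !ReImE; ring.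
by apply: (is_derive_ext (lin (ImC z) (ImC w))) => // u; rewrite !ReImE; ring.
Qed.

Lemma cderiv_expC g s d : cderiv g s d ->
  cderiv (fun u => expC (g u)) s (d * expC (g s)).
Proof.
move=> [r i].
have re := is_derive1_comp (is_derive_expR (ReC (g s))) r.
have rc := is_derive1_comp (is_derive_cos (ImC (g s))) i.
have rs := is_derive1_comp (is_derive_sin (ImC (g s))) i.
split.
  apply: (is_derive_ext (is_deriveM re rc)) => [u|]; first by rewrite ReC_expC.
    by rewrite ReCM ReC_expC ImC_expC /GRing.scale /=; ring.
apply: (is_derive_ext (is_deriveM re rs)) => [u|]; first by rewrite ImC_expC.
  by rewrite ImCM ReC_expC ImC_expC /GRing.scale /=; ring.
Qed.

(** The factor 2 is the price of applying the mean value theorem separately to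
the real and the imaginary part. *)
Lemma cderiv_bound (g dg : R -> Cx R) l K : 0 <= l ->
  (forall s, cderiv g s (dg s)) ->
  (forall s, 0 <= s <= l -> modC (dg s) <= K) ->
  modC (g l - g 0) <= 2 * K * l.
Proof.
move=> l0 Hg HK.
have cont (f df : R -> R) : (forall s, is_derive s 1 f (df s)) ->
    (forall s, 0 <= s <= l -> `|df s| <= K) -> `|f l - f 0| <= K * l.
  move=> Hf Hdf.
  have fcont : {within `[0, l], continuous f}.
    apply/continuous_subspaceT => r.
    by apply/differentiable_continuous/derivable1_diffP; case: (Hf r).
  have [c] := MVT_segment l0 (fun s _ => Hf s) fcont.
  rewrite in_itv /= => cl ->; rewrite normrM subr0 (ger0_norm l0).
  by rewrite ler_wpM2r // Hdf.
apply: le_trans (modC_le _) _.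
have -> : 2 * K * l = K * l + K * l by ring.
apply: lerD; rewrite !ReImE.
  apply: (cont (fun u => ReC (g u)) (fun u => ReC (dg u))) => [s|s sl].
    by case: (Hg s).
  exact: le_trans (ReC_le _) (HK s sl).
apply: (cont (fun u => ImC (g u)) (fun u => ImC (dg u))) => [s|s sl].
  by case: (Hg s).
exact: le_trans (ImC_le _) (HK s sl).
Qed.

(** Weaker than complex differentiability, but enough to integrate along segments,
and obviously stable under products, translations and the exponential. *)
Definition line_deriv (f f' : Cx R -> Cx R) : Prop :=
  forall z w s, cderiv (fun u => f (z + ofR u * w)) s (w * f' (z + ofR s * w)).

Lemma derivable_error (f : Cx R -> Cx R) t : derivable f t 1 ->
  forall e : R, 0 < e -> exists2 r : R, 0 < r &
    forall h : Cx R, modC h < r ->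
      modC (f (t + h) - f t - h * derive1 f t) <= e * modC h.
Proof.
move=> df e e0; set d := derive1 f t.
have lim : h^-1 *: ((f \o shift t) (h *: 1) - f t) @[h --> 0^'] --> d.
  by rewrite /d derive1E; exact: df.
have e0' : 0 < ofR e by rewrite ltcR.
have /cvgrPdist_le /(_ _ e0') /nbhs_ballP [r /= r0 Hr] := lim.
have rE : r = ofR (ReC r).
  by apply: CxP => //=; move: r0; rewrite ltcE => /andP[/eqP + _].
exists (ReC r); first by move: r0; rewrite rE ltcR.
move=> h hr.
have [->|h0] := eqVneq h 0; first by rewrite mul0r !addr0 subrr modC0 subr0 modC0 mulr0.
have := Hr h; rewrite /ball /= sub0r normrN rE normCx ltcR => /(_ hr h0).
rewrite normCx lecR => hle.
have -> : f (t + h) - f t - h * d = - (h * (d - h^-1 *: (f (h *: 1 + t) - f t))).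
  rewrite /GRing.scale /= mulr1 mulrBr mulrA mulfV // mul1r (addrC h) opprB.
  by [].
by rewrite modCN modCM mulrC ler_wpM2r ?modC_ge0.
Qed.

Lemma derivable_line_deriv (f : Cx R -> Cx R) :
  (forall t, derivable f t 1) -> line_deriv f (derive1 f).
Proof.
move=> df z w s; set t := z + ofR s * w; set d := derive1 f t.
have err (e : R) : 0 < e -> exists2 r : R, 0 < r & forall h : R, `|h| < r ->
    modC (f (z + ofR (s + h) * w) - f t - ofR h * (w * d)) <= e * `|h|.
  move=> e0; have w1 : 0 < modC w + 1 by rewrite ltr_wpDl ?modC_ge0.
  have [r r0 Hr] := @derivable_error f t (df t) (e / (modC w + 1)) (divr_gt0 e0 w1).
  exists (r / (modC w + 1)) => [|h]; first exact: divr_gt0.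
  rewrite ltr_pdivlMr // => hr.
  have mh : modC (ofR h * w) <= `|h| * (modC w + 1).
    by rewrite modCM modC_ofR ler_wpM2l // lerDl.
  have := Hr (ofR h * w) (le_lt_trans mh hr).
  have -> : t + ofR h * w = z + ofR (s + h) * w by rewrite /t ofRD; ring.
  rewrite -/d mulrA => /le_trans; apply.
  apply: le_trans (_ : e / (modC w + 1) * (`|h| * (modC w + 1)) <= _).
    by rewrite ler_wpM2l // divr_ge0 // ltW.
  by rewrite [leLHS](_ : _ = e * `|h|) //; field; rewrite gt_eqF.
split; apply: is_derive_of_error => e e0; have [r r0 Hr] := err e e0; exists r => // h hr.
  apply: le_trans (Hr h hr); apply: le_trans (ReC_le _).
  by rewrite -/t -/d !ReImE mul0r subr0.
apply: le_trans (Hr h hr); apply: le_trans (ImC_le _).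
by rewrite -/t -/d !ReImE mul0r addr0.
Qed.

End Curves.

(** * Line derivatives, energy growth and Wronskian *)

Section LineDerivatives.
Local Open Scope classical_set_scope.
Context {R : realType}.
Implicit Types (z w c d t : Cx R) (s x y : R) (f g : Cx R -> Cx R).

Lemma line_deriv_eq f f' g' : line_deriv f f' -> f' =1 g' -> line_deriv f g'.
Proof. by move=> h /funext <-. Qed.

Lemma line_deriv_unique f f' g' : line_deriv f f' -> line_deriv f g' -> f' =1 g'.
Proof.
move=> h1 h2 z; have := cderiv_unique (h1 z 1 0) (h2 z 1 0).
by rewrite !mul0r !mul1r addr0.
Qed.

Lemma line_derivD f f' g g' : line_deriv f f' -> line_deriv g g' ->
  line_deriv (fun t => f t + g t) (fun t => f' t + g' t).
Proof. by move=> hf hg z w s; rewrite mulrDr; exact: cderivD. Qed.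

Lemma line_derivM f f' g g' : line_deriv f f' -> line_deriv g g' ->
  line_deriv (fun t => f t * g t) (fun t => f' t * g t + f t * g' t).
Proof.
move=> hf hg z w s; apply: cderiv_eq (cderivM (hf z w s) (hg z w s)) _; ring.
Qed.

Lemma line_derivZ c f f' : line_deriv f f' ->
  line_deriv (fun t => c * f t) (fun t => c * f' t).
Proof.
move=> hf z w s; apply: cderiv_eq (cderivM (cderiv_cst c s) (hf z w s)) _; ring.
Qed.

Lemma line_deriv_expC c :
  line_deriv (fun t => expC (c * t)) (fun t => c * expC (c * t)).
Proof.
move=> z w s.
have := cderiv_expC (cderivM (cderiv_cst c s) (cderiv_line z w s)).
by move/cderiv_eq; apply; ring.
Qed.

Lemma line_deriv_shift c f f' : line_deriv f f' ->
  line_deriv (fun t => f (t + c)) (fun t => f' (t + c)).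
Proof.
move=> hf z w s.
have -> : (fun u => f (z + ofR u * w + c)) = (fun u => f (z + c + ofR u * w)).
  by apply: funext => u; rewrite addrAC.
by rewrite addrAC; exact: hf.
Qed.

Lemma line_deriv0_cst f : line_deriv f (fun=> 0) -> forall z z', f z = f z'.
Proof.
move=> hf z z'.
have H := cderiv_bound (l := 1) (K := 0) ler01 (hf z (z' - z)).
have /H : forall s, 0 <= s <= 1 -> modC ((z' - z) * 0) <= 0.
  by move=> s _; rewrite mulr0 modC0.
rewrite mulr0 mul0r ofR1 ofR0 mul1r mul0r addr0 addrCA subrr addr0 => h.
apply/esym/eqP; rewrite -subr_eq0; apply/eqP/modC_eq0/le_anti.
by rewrite h modC_ge0.
Qed.

Lemma inner_le z w : ReC z * ReC w + ImC z * ImC w <= modC z * modC w.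
Proof.
apply: le_trans (ler_norm _) _.
rewrite -(ler_pXn2r (n:=2)) ?nnegrE ?mulr_ge0 ?modC_ge0 // real_normK ?num_real //.
rewrite exprMn !modC_sqr -subr_ge0.
have -> : (ReC z ^+ 2 + ImC z ^+ 2) * (ReC w ^+ 2 + ImC w ^+ 2) -
  (ReC z * ReC w + ImC z * ImC w) ^+ 2 = (ReC z * ImC w - ImC z * ReC w) ^+ 2 by ring.
exact: sqr_ge0.
Qed.

Lemma modC_sqr_deriv (g : R -> Cx R) s d : cderiv g s d ->
  is_derive s 1 (fun u => modC (g u) ^+ 2)
    (2 * (ReC (g s) * ReC d + ImC (g s) * ImC d)).
Proof.
move=> [r i].
apply: (is_derive_ext (is_deriveD (is_deriveM r r) (is_deriveM i i))) => [u|].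
  by rewrite modC_sqr !expr2.
by rewrite /GRing.scale /=; ring.
Qed.

(** Gronwall's inequality: e(u) exp (- L u) has nonpositive derivative. *)
Lemma gronwall_real (e de : R -> R) L l : 0 <= l ->
  (forall s, is_derive s 1 e (de s)) ->
  (forall s, 0 <= s <= l -> de s <= L * e s) ->
  e l <= expR (L * l) * e 0.
Proof.
move=> l0 he hde.
have hx s : is_derive s 1 (fun u => expR (- L * u)) (- L * expR (- L * s)).
  have h1 := is_deriveM (is_derive_cst (- L) s 1) (is_derive_id s 1).
  apply: (is_derive_ext (is_derive1_comp (is_derive_expR _) h1)) => [u|] //.
  by rewrite /GRing.scale /=; ring.
pose F u := expR (- L * u) * e u.
have hF s : is_derive s 1 F (expR (- L * s) * (de s - L * e s)).
  apply: (is_derive_ext (is_deriveM (hx s) (he s))) => [u|] //.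
  by rewrite /GRing.scale /=; ring.
have Fcont : {within `[0, l], continuous F}.
  apply/continuous_subspaceT => r.
  by apply/differentiable_continuous/derivable1_diffP; case: (hF r).
have [c] := MVT_segment l0 (fun s _ => hF s) Fcont.
rewrite in_itv /= => cl; rewrite subr0 /F mulr0 expR0 mul1r => E.
have : expR (- L * l) * e l - e 0 <= 0.
  rewrite E mulr_le0_ge0 // mulr_ge0_le0 ?expR_ge0 // subr_le0; exact: hde.
rewrite subr_le0 => h.
have -> : e l = expR (L * l) * (expR (- L * l) * e l).
  by rewrite mulrA -expRD mulNr subrr expR0 mul1r.
by rewrite ler_wpM2l ?expR_ge0.
Qed.

(** In the variable t = log x, with f1 the derivative of f, the equation
x^2 Phi'' = P Phi becomes f'' - f' = q f where q(t) = P(e^t). *)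
Definition solves (q f f1 : Cx R -> Cx R) : Prop :=
  line_deriv f f1 /\ line_deriv f1 (fun t => f1 t + q t * f t).

Lemma solves_comb q f f1 g g1 c d : solves q f f1 -> solves q g g1 ->
  solves q (fun t => c * f t + d * g t) (fun t => c * f1 t + d * g1 t).
Proof.
move=> [hf hf1] [hg hg1]; split; first by apply: line_derivD; apply: line_derivZ.
apply: line_deriv_eq (line_derivD (line_derivZ c hf1) (line_derivZ d hg1)) _ => t.
ring.
Qed.

Definition energy (f f1 : Cx R -> Cx R) t : R := modC (f t) ^+ 2 + modC (f1 t) ^+ 2.

(** |2 Re (conj f . w f')| is at most the energy, and so on: the logarithmic
derivative of the energy along a unit direction is at most 3 + |q|. *)
Lemma energy_growth q f f1 z w l Q : solves q f f1 -> modC w = 1 -> 0 <= l ->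
  (forall s, 0 <= s <= l -> modC (q (z + ofR s * w)) <= Q) ->
  energy f f1 (z + ofR l * w) <= expR ((3 + Q) * l) * energy f f1 z.
Proof.
move=> [hf hf1] w1 l0 hQ.
pose e u := energy f f1 (z + ofR u * w).
have he s := is_deriveD (modC_sqr_deriv (hf z w s)) (modC_sqr_deriv (hf1 z w s)).
have -> : energy f f1 z = e 0 by rewrite /e ofR0 mul0r addr0.
apply: (@gronwall_real e _ (3 + Q) l l0 he) => s sl.
rewrite /e /energy; set t := z + ofR s * w.
have i1 := inner_le (f t) (w * f1 t).
have i2 := inner_le (f1 t) (w * (f1 t + q t * f t)).
rewrite !modCM w1 !mul1r in i1 i2.
have m := modCD (f1 t) (q t * f t); rewrite modCM in m.
have q1 := hQ s sl; rewrite -/t in q1.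
set A := modC (f t) in i1 i2 m *; set B := modC (f1 t) in i1 i2 m *.
have A0 : 0 <= A := modC_ge0 _.
have B0 : 0 <= B := modC_ge0 _.
have Q0 : 0 <= Q := le_trans (modC_ge0 _) q1.
have m1 : B * modC (f1 t + q t * f t) <= B * (B + Q * A).
  by apply: ler_wpM2l => //; apply: le_trans m _; rewrite lerD2l ler_wpM2r.
have AB : 2 * (A * B) <= A ^+ 2 + B ^+ 2.
  by rewrite -subr_ge0 (_ : _ - _ = (A - B) ^+ 2) ?sqr_ge0 //; ring.
have QAB : Q * (2 * (A * B)) <= Q * (A ^+ 2 + B ^+ 2) by rewrite ler_wpM2l.
have B2 := sqr_ge0 B; have A2 := sqr_ge0 A.
nra.
Qed.

Definition wronskian f f1 g g1 (t : Cx R) : Cx R := f t * g1 t - f1 t * g t.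

(** The first order term of f'' = f' + q f makes the Wronskian proportional to e^t;
in particular it is 2 i pi periodic, so the monodromy has determinant 1. *)
Lemma wronskianE q f f1 g g1 : solves q f f1 -> solves q g g1 ->
  forall t t', expC (- t) * wronskian f f1 g g1 t
    = expC (- t') * wronskian f f1 g g1 t'.
Proof.
move=> [hf hf1] [hg hg1]; apply: line_deriv0_cst.
have he := line_deriv_expC (-1).
have h := line_derivM he (line_derivD (line_derivM hf hg1)
  (line_derivZ (-1) (line_derivM hf1 hg))).
have -> : (fun t => expC (- t) * wronskian f f1 g g1 t) =
  (fun t => expC (-1 * t) * (f t * g1 t + -1 * (f1 t * g t))).
  by apply: funext => t; rewrite /wronskian !mulN1r.
by apply: line_deriv_eq h _ => t; ring.
Qed.

End LineDerivatives.

(** * Trace of the monodromy around the regular singularity *)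

Section MonodromyTrace.
Context {R : realType}.
Implicit Types (z w c d t : Cx R) (x y : R) (f g : Cx R -> Cx R).

(** One positive turn of x around the origin, seen in the variable log x. *)
Definition turn : Cx R := 2 * Ci R * ofR pi.

Lemma turnE : turn = ofR (2 * pi) * Ci R.
Proof. by rewrite ofRM ofR_nat /turn; ring. Qed.

Lemma wronskian_turn q f f1 g g1 t : solves q f f1 -> solves q g g1 ->
  wronskian f f1 g g1 (t + turn) = wronskian f f1 g g1 t.
Proof.
move=> hf hg; have := wronskianE hf hg t (t + turn).
rewrite opprD expCD (expCNV turn) expC_2pi invr1 mulr1.
by move=> /(mulfI (expC_neq0 _)) ->.
Qed.

Lemma modC_expC_turn_le (s : Cx R) x : 0 <= x <= 2 * pi ->
  modC (expC (s * (ofR x * Ci R))) <= expR (2 * pi * modC s).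
Proof.
move=> /andP[x0 xpi]; rewrite modC_expC ler_expR.
apply: le_trans (ler_norm _) (le_trans (ReC_le _) _).
by rewrite !modCM modC_ofR modC_Ci mulr1 ger0_norm // mulrC ler_wpM2r // modC_ge0.
Qed.

(** The function h = f' - (1 - s) f satisfies h' = s h + (q - s (s - 1)) f: when q
is close to s (s - 1), one turn multiplies h by nearly e^(2 i pi s).  The constant
depends only on s and on a bound of q, which allows t to go to infinity. *)
Lemma turn_estimate (s : Cx R) (Q : R) : exists2 K : R, 0 <= K &
  forall q f f1 t eta, solves q f f1 -> energy f f1 t <= 1 ->
    (forall x : R, 0 <= x <= 2 * pi -> modC (q (t + ofR x * Ci R)) <= Q) ->
    (forall x : R, 0 <= x <= 2 * pi ->
       modC (q (t + ofR x * Ci R) - s * (s - 1)) <= eta) ->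
    [/\ modC (f (t + turn)) <= K, modC (f1 (t + turn)) <= K &
      modC (f1 (t + turn) - (1 - s) * f (t + turn)
        - expC (s * turn) * (f1 t - (1 - s) * f t)) <= K * eta].
Proof.
pose B := expR ((3 + `|Q|) * (2 * pi)).
pose M := expR (2 * pi * modC s).
have pi0 : 0 <= 2 * pi :> R by rewrite mulr_ge0 // pi_ge0.
have B1 : 1 <= B.
  by rewrite -expR0 ler_expR mulr_ge0 // addr_ge0.
have M1 : 1 <= M by rewrite -expR0 ler_expR mulr_ge0 // modC_ge0.
pose D := M * (2 * (M * B) * (2 * pi)).
have D0 : 0 <= D by rewrite /D !mulr_ge0 // ?pi_ge0 //; lra.
exists (B + D) => [|q f f1 t eta sol en hQ heta]; first by lra.
have eta0 : 0 <= eta.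
  by apply: le_trans (modC_ge0 _) (heta 0 _); rewrite lexx.
have [hf hf1] := sol.
have grow x : 0 <= x <= 2 * pi -> energy f f1 (t + ofR x * Ci R) <= B.
  move=> /andP[x0 xpi].
  apply: le_trans (energy_growth (l := x) (Q := `|Q|) sol modC_Ci x0 _) _.
    move=> y /andP[y0 yx]; apply: le_trans (ler_norm _).
    by apply: hQ; rewrite y0 (le_trans yx).
  rewrite -[leRHS]mulr1; apply: ler_pM; rewrite ?expR_ge0 //.
    by rewrite addr_ge0 // sqr_ge0.
  by rewrite ler_expR ler_wpM2l // addr_ge0.
have root a b : a ^+ 2 + b ^+ 2 <= B -> 0 <= a -> a <= B.
  move=> h a0; rewrite leNgt; apply/negP => Ba.
  have b2 := sqr_ge0 b; nra.
have fB x : 0 <= x <= 2 * pi -> modC (f (t + ofR x * Ci R)) <= B.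
  by move=> hx; exact: root (grow x hx) (modC_ge0 _).
have f1B : modC (f1 (t + turn)) <= B.
  rewrite turnE; apply: (@root _ (modC (f (t + ofR (2 * pi) * Ci R)))) (modC_ge0 _).
  by rewrite addrC; apply: grow; rewrite pi0 lexx.
have last : 0 <= (2 * pi : R) <= 2 * pi by rewrite pi0 lexx.
split.
- by rewrite turnE; apply: le_trans (fB _ last) _; lra.
- by apply: le_trans f1B _; lra.
(* Solving h' = s h + ... by variation of constants: y = e^(- s (u - t)) h(u). *)
pose y u := expC (s * t) * (expC (- s * u) * (f1 u + (- (1 - s)) * f u)).
have hy : line_deriv y (fun u =>
    expC (s * t) * (expC (- s * u) * ((q u - s * (s - 1)) * f u))).
  apply: line_deriv_eq (line_derivZ _ (line_derivM (line_deriv_expC (- s))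
    (line_derivD hf1 (line_derivZ _ hf)))) _ => u.
  by ring.
have bd := cderiv_bound (K := M * (eta * B)) pi0 (hy t (Ci R)).
have {bd} : modC (y (t + ofR (2 * pi) * Ci R) - y (t + ofR 0 * Ci R)) <=
    2 * (M * (eta * B)) * (2 * pi).
  apply: bd => x hx; set u := t + _.
  rewrite modCM modC_Ci mul1r mulrA -expCD modCM.
  apply: ler_pM; rewrite ?modC_ge0 //.
    have -> : s * t + - s * u = - s * (ofR x * Ci R) by rewrite /u; ring.
    by have := @modC_expC_turn_le (- s) x hx; rewrite modCN.
  by rewrite modCM; apply: ler_pM; rewrite ?modC_ge0 ?heta ?fB.
rewrite ofR0 mul0r addr0 -turnE /y => hle.
have -> : f1 (t + turn) - (1 - s) * f (t + turn) -
    expC (s * turn) * (f1 t - (1 - s) * f t) =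
  expC (s * turn) * (y (t + turn) - y t).
  rewrite /y.
  have -> : expC (- s * (t + turn)) = expC (- (s * t)) * expC (- (s * turn)).
    by rewrite -expCD; congr expC; ring.
  rewrite [expC (- s * t)](_ : _ = expC (- (s * t))); last by rewrite mulNr.
  have alg (P P' L L' X Y : Cx R) : P' * P = 1 -> L' * L = 1 ->
      X - L * Y = L * (P * (P' * L' * X) - P * (P' * Y)).
    move=> e1 e2; transitivity ((L' * L) * (P' * P) * X - (P' * P) * L * Y); last by ring.
    by rewrite e1 e2 !mul1r.
  by rewrite !mulNr; apply: alg; exact: expCN.
have hM : modC (expC (s * turn)) <= M by rewrite turnE; exact: modC_expC_turn_le.
rewrite modCM; apply: le_trans (_ : D * eta <= _).
  have -> : D * eta = M * (2 * (M * (eta * B)) * (2 * pi)) by rewrite /D; ring.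
  by apply: ler_pM; rewrite ?modC_ge0.
by rewrite ler_wpM2r //; lra.
Qed.

Lemma eq0_of_le_expRN (d : R) K : 0 <= d -> 0 <= K ->
  (forall N : R, 0 <= N -> d <= K * expR (- N)) -> d = 0.
Proof.
move=> d0 K0 H; apply/le_anti; rewrite d0 andbT leNgt; apply/negP => dp.
have N0 : 0 <= K / d by rewrite divr_ge0.
have := H _ N0; rewrite expRN => h.
have e0 := expR_gt0 (K / d).
have e1 := expR_ge1Dx (K / d).
have : d * expR (K / d) <= K.
  by rewrite -ler_pdivlMr.
have : d * (1 + K / d) <= d * expR (K / d) by rewrite ler_wpM2l.
have -> : d * (1 + K / d) = d + K by field; rewrite gt_eqF.
by lra.
Qed.

Lemma energy_unit f f1 t : (f t = 1 /\ f1 t = 0) \/ (f t = 0 /\ f1 t = 1) ->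
  energy f f1 t <= 1.
Proof.
by rewrite /energy; case=> [] [-> ->]; rewrite modC0 modC1 expr0n expr1n ?addr0 ?add0r.
Qed.

(** Here l = e^(2 i pi s), and tr is the trace of the monodromy X in the basis of
solutions normalised at t.  The previous estimate says that (X - l) v is small for
v = (s - 1, 1), so the characteristic polynomial of X is small at l. *)
Lemma trace_defect (s : Cx R) (Q : R) : exists2 K : R, 0 <= K &
  forall q f f1 g g1 t eta, solves q f f1 -> solves q g g1 ->
    wronskian f f1 g g1 t != 0 ->
    (forall x : R, 0 <= x <= 2 * pi -> modC (q (t + ofR x * Ci R)) <= Q) ->
    (forall x : R, 0 <= x <= 2 * pi ->
       modC (q (t + ofR x * Ci R) - s * (s - 1)) <= eta) ->
    forall tr, tr * wronskian f f1 g g1 t =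
      g1 t * f (t + turn) - f1 t * g (t + turn)
      - g t * f1 (t + turn) + f t * g1 (t + turn) ->
    modC (expC (s * turn) ^+ 2 - expC (s * turn) * tr + 1) <= K * eta.
Proof.
have [K K0 HK] := turn_estimate s Q.
move: HK; move: (expC (s * turn)) => l HK.
exists ((K + modC l) * K + K * K) => [|q f f1 g g1 t eta hf hg W0 hQ heta].
  by rewrite addr_ge0 ?mulr_ge0 ?addr_ge0 ?modC_ge0.
set W := wronskian f f1 g g1 t in W0 *.
have eta0 : 0 <= eta.
  by apply: le_trans (modC_ge0 _) (heta 0 _); rewrite lexx mulr_ge0 // pi_ge0.
have W1 : f (t + turn) * g1 (t + turn) - f1 (t + turn) * g (t + turn) = W.
  exact: wronskian_turn hf hg.
have W0' : f t * g1 t - f1 t * g t != 0 by [].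
(* The solutions with initial data (1, 0) and (0, 1) at t. *)
pose G u := g1 t / W * f u + - f1 t / W * g u.
pose G1 u := g1 t / W * f1 u + - f1 t / W * g1 u.
pose H u := - g t / W * f u + f t / W * g u.
pose H1 u := - g t / W * f1 u + f t / W * g1 u.
have sG : solves q G G1 by exact: solves_comb.
have sH : solves q H H1 by exact: solves_comb.
have Gt : G t = 1 by rewrite /G /W /wronskian; field.
have G1t : G1 t = 0 by rewrite /G1 /W /wronskian; field.
have Ht : H t = 0 by rewrite /H /W /wronskian; field.
have H1t : H1 t = 1 by rewrite /H1 /W /wronskian; field.
have [KG _ dG] := HK q G G1 t eta sG (energy_unit (or_introl (conj Gt G1t))) hQ heta.
have [KH _ dH] := HK q H H1 t eta sH (energy_unit (or_intror (conj Ht H1t))) hQ heta.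
rewrite Ht H1t mulr0 subr0 mulr1 in dH.
rewrite Gt G1t mulr1 sub0r in dG.
move=> tr; rewrite -/W => htr.
have trE : tr = G (t + turn) + H1 (t + turn).
  by apply: (mulIf W0); rewrite htr /G /H1; field.
have det1 : G (t + turn) * H1 (t + turn) - G1 (t + turn) * H (t + turn) = 1.
  transitivity (wronskian f f1 g g1 t * W^-1 ^+ 2 *
    (f (t + turn) * g1 (t + turn) - f1 (t + turn) * g (t + turn))).
    by rewrite /G /G1 /H /H1 /wronskian; ring.
  by rewrite W1 -/W; field.
(* det (X - m) expressed through the two components of (X - m) (- r, 1). *)
have alg (x11 x12 x21 x22 r m : Cx R) : x11 * x22 - x12 * x21 = 1 ->
    m ^+ 2 - m * (x11 + x22) + 1 = (x11 - m) * (x22 - r * x21 - m)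
      - (x12 - r * x11 - m * - r) * x21.
  by move=> e; rewrite -e; ring.
rewrite trE (alg _ _ _ _ (1 - s) l det1).
apply: le_trans (modCB _ _) _; rewrite !modCM.
have split_bound (k m e : R) :
    ((k + m) * k + k * k) * e = (k + m) * (k * e) + k * e * k by ring.
rewrite split_bound.
apply: lerD; last by apply: ler_pM; rewrite ?modC_ge0.
apply: ler_pM; rewrite ?modC_ge0 //.
by apply: le_trans (modCB _ _) _; rewrite lerD2r.
Qed.

(** T is conjugate to the inverse of the monodromy, whose determinant is 1, so both
have the same trace.  Translating the base point to Re t = - N makes the defect of
the previous lemma as small as desired, while T stays the same. *)
Theorem connection_trace q f f1 g g1 (T11 T12 T21 T22 s : Cx R) (c : R) :
  solves q f f1 -> solves q g g1 -> (exists t, wronskian f f1 g g1 t != 0) ->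
  (forall t, f t = T11 * f (t + turn) + T12 * g (t + turn)) ->
  (forall t, g t = T21 * f (t + turn) + T22 * g (t + turn)) ->
  (forall t, ReC t <= 0 -> modC (q t - s * (s - 1)) <= c * expR (ReC t)) ->
  T11 + T22 = expC (s * turn) + expC (- (s * turn)).
Proof.
move=> hf hg [t1 W1] Tf Tg hq.
have Tf1 t : f1 t = T11 * f1 (t + turn) + T12 * g1 (t + turn).
  move: t; apply: (line_deriv_unique hf.1); rewrite (funext Tf).
  by apply: line_derivD; apply: line_derivZ; apply: line_deriv_shift;
    [exact: hf.1 | exact: hg.1].
have Tg1 t : g1 t = T21 * f1 (t + turn) + T22 * g1 (t + turn).
  move: t; apply: (line_deriv_unique hg.1); rewrite (funext Tg).
  by apply: line_derivD; apply: line_derivZ; apply: line_deriv_shift;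
    [exact: hf.1 | exact: hg.1].
have W0 t : wronskian f f1 g g1 t != 0.
  apply: contraNneq W1 => Wt; have := wronskianE hf hg t1 t.
  by rewrite Wt mulr0 => /eqP; rewrite mulf_eq0 (negbTE (expC_neq0 _)).
have c0 : 0 <= c.
  have := hq 0 (lexx _); rewrite expR0 mulr1; exact: le_trans (modC_ge0 _).
have [K K0 HK] := trace_defect s (c + modC (s * (s - 1))).
set tr := T11 + T22; have l0 := expC_neq0 (s * turn).
move: l0 HK; rewrite expCNV; move: (expC (s * turn)) => l l0 HK.
have /eqP : modC (l ^+ 2 - l * tr + 1) = 0.
  apply: (eq0_of_le_expRN (K := K * c)); rewrite ?modC_ge0 ?mulr_ge0 // => N N0.
  pose t : Cx R := ofR (- N).
  have Ret x : ReC (t + ofR x * Ci R) = - N by rewrite !ReImE; ring.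
  have hq' x : modC (q (t + ofR x * Ci R) - s * (s - 1)) <= c * expR (- N).
    by rewrite -(Ret x); apply: hq; rewrite Ret oppr_le0.
  apply: le_trans (HK q f f1 g g1 t _ hf hg (W0 t) _ (fun x _ => hq' x) tr _) _;
    last by rewrite mulrA.
    move=> x _.
    rewrite -(subrK (s * (s - 1)) (q _)); apply: le_trans (modCD _ _) _.
    rewrite lerD2r; apply: le_trans (hq' x) _.
    by rewrite ler_piMr // -expR0 ler_expR oppr_le0.
  rewrite -(wronskian_turn t hf hg) /wronskian.
  by rewrite (Tf1 t) (Tg1 t) (Tf t) (Tg t) /tr; ring.
move=> /eqP /modC_eq0 e.
apply: (mulfI l0); rewrite [RHS]mulrDr mulfV // -expr2.
by apply/eqP; rewrite -subr_eq0 -oppr_eq0 opprB -e; apply/eqP; ring.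
Qed.

End MonodromyTrace.

(** * The equation in the logarithmic variable *)

Section TheEquation.
Context {R : realType}.
Implicit Types (z w c d t : Cx R) (x y : R) (f g : Cx R -> Cx R).

Definition potential m (a : 'rV[Cx R]_m) t : Cx R := (Pm a).[expC t].

Lemma is_solution_solves m (a : 'rV[Cx R]_m) F :
  is_solution a F -> solves (potential a) F (derive1 F).
Proof.
move=> sol; split; first by apply: derivable_line_deriv => t; case: (sol t).
have dG : line_deriv (Dx F) (derive1 (Dx F)).
  by apply: derivable_line_deriv => t; case: (sol t).
have -> : derive1 F = fun t => expC (1 * t) * Dx F t.
  apply: funext => t; rewrite mul1r /Dx mulrA expCNV mulfV ?mul1r //.
  exact: expC_neq0.
apply: line_deriv_eq (line_derivM (line_deriv_expC 1) dG) _ => t.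
rewrite !mul1r; congr (_ + _).
have [_ _] := sol t; rewrite {1}/Dx expCNV -/(potential a t).
move: (expC_neq0 t); move: (expC t) => e e0 h.
have -> : derive1 (Dx F) t = e * (e^-1 * derive1 (Dx F) t).
  by rewrite mulrA mulfV // mul1r.
by rewrite h; field.
Qed.

Lemma solves_shift q f f1 c : solves q f f1 ->
  solves (fun t => q (t + c)) (fun t => f (t + c)) (fun t => f1 (t + c)).
Proof.
by move=> [hf hf1]; split; [exact: (line_deriv_shift c hf) | exact: (line_deriv_shift c hf1)].
Qed.

Lemma horner_bounded (p : {poly Cx R}) (r : R) : 0 <= r ->
  exists2 M : R, 0 <= M & forall z, modC z <= r -> modC p.[z] <= M.
Proof.
move=> r0; elim/poly_ind: p => [|p c [M M0 HM]].
  by exists 0 => // z _; rewrite horner0 modC0.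
exists (M * r + modC c) => [|z zr]; first by rewrite addr_ge0 ?mulr_ge0 ?modC_ge0.
rewrite hornerMXaddC; apply: le_trans (modCD _ _) _.
by rewrite lerD2r modCM; apply: ler_pM; rewrite ?modC_ge0 ?HM.
Qed.

Lemma Pm_horner m (a : 'rV[Cx R]_m) z :
  (Pm a).[z] = z ^+ m + \sum_(i < m) a 0 i * z ^+ (m - i.+1).
Proof.
rewrite /Pm hornerD hornerXn horner_sum; congr (_ + _).
by apply: eq_bigr => i _; rewrite hornerZ hornerXn.
Qed.

Lemma Pm_horner0 n (a : 'rV[Cx R]_n.+1) : (Pm a).[0] = a 0 ord_max.
Proof.
rewrite Pm_horner exprS mul0r add0r big_ord_recr /= subnn expr0 mulr1.
rewrite big1 ?add0r // => i _.
by rewrite /= subSS expr0n subn_eq0 leqNgt ltn_ord mulr0.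
Qed.

Lemma potential_bounded m (a : 'rV[Cx R]_m) (r : R) :
  exists Q : R, forall t, ReC t <= r -> modC (potential a t) <= Q.
Proof.
have [M _ HM] := horner_bounded (Pm a) (expR_ge0 r).
by exists M => t tr; apply: HM; rewrite modC_expC ler_expR.
Qed.

(** The value at x = 0 is a_m, and P_m - a_m is divisible by x. *)
Lemma potential_limit n (a : 'rV[Cx R]_n.+1) : exists c : R, forall t,
  ReC t <= 0 -> modC (potential a t - a 0 ord_max) <= c * expR (ReC t).
Proof.
have [p pE] : exists p, Pm a = p * 'X + (a 0 ord_max)%:P.
  have := Pm_horner0 a; elim/poly_ind: (Pm a) => [|p c _].
    by rewrite horner0 => <-; exists 0; rewrite mul0r addr0.
  by rewrite hornerMXaddC mulr0 add0r => <-; exists p.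
have [M _ HM] := horner_bounded p (@ler01 R).
exists M => t t0; rewrite /potential pE hornerMXaddC addrK modCM modC_expC.
by rewrite ler_wpM2r ?expR_ge0 // HM // modC_expC -expR0 ler_expR.
Qed.

Lemma expC_turn_int (k : int) : expC (2 * Ci R * ofR pi * k%:~R) = 1.
Proof.
case: k => k; first by rewrite -pmulrn mulrC expCMn expC_2pi expr1n.
rewrite NegzE mulrNz -pmulrn mulrN expCNV mulrC expCMn expC_2pi expr1n.
by rewrite invr1.
Qed.

(** P_m(omega x, omega . a) = omega^m P_m(x, a) by homogeneity, and omega^m = 1. *)
Lemma potential_rescale n (a : 'rV[Cx R]_n.+1) (k : int) t :
  potential (rescale (omega n.+1 k%:~R) a)
    (t + 2 * Ci R * ofR pi * k%:~R / n.+1%:R) = potential a t.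
Proof.
rewrite /potential expCD -/(omega n.+1 k%:~R) !Pm_horner.
have om : omega n.+1 (k%:~R : Cx R) ^+ n.+1 = 1.
  by rewrite -expCMn mulrCA mulfV ?mulr1 ?expC_turn_int // pnatr_eq0.
move: om; move: (omega _ _) (expC t) => e x om.
rewrite exprMn om mulr1; congr (_ + _); apply: eq_bigr => i _.
rewrite mxE exprMn.
transitivity (e ^+ i.+1 * e ^+ (n.+1 - i.+1) * (a 0 i * x ^+ (n.+1 - i.+1))).
  by ring.
by rewrite -exprD subnKC ?ltn_ord // om mul1r.
Qed.

(** The combination g(x1) f - f(x1) g has zero initial data at x1, its derivative
there being minus the Wronskian; the energy estimate then makes it vanish. *)
Lemma proportional_of_wronskian0 q f f1 g g1 x1 :
  solves q f f1 -> solves q g g1 -> wronskian f f1 g g1 (ofR x1) = 0 ->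
  (forall r, exists Q : R, forall t, ReC t <= r -> modC (q t) <= Q) ->
  forall x, x1 <= x -> g (ofR x1) * f (ofR x) = f (ofR x1) * g (ofR x).
Proof.
move=> hf hg W0 hq x xx1; have [Q HQ] := hq x.
have hk := solves_comb (g (ofR x1)) (- f (ofR x1)) hf hg.
have l0 : 0 <= x - x1 by rewrite subr_ge0.
have := energy_growth (z := ofR x1) (w := 1) (Q := Q) hk modC1 l0.
set en := energy _ _; have -> : en (ofR x1) = 0.
  have k0 : g (ofR x1) * f (ofR x1) + - f (ofR x1) * g (ofR x1) = 0 by ring.
  have k1 : g (ofR x1) * f1 (ofR x1) + - f (ofR x1) * g1 (ofR x1) = 0.
    by rewrite -oppr0 -W0 /wronskian; ring.
  by rewrite /en /energy k0 k1 modC0 expr0n addr0.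
rewrite mulr0 mulr1 -ofRD addrCA subrr addr0 => H.
have {}H : en (ofR x) <= 0.
  apply: H => s /andP[s0 sl]; apply: HQ.
  by rewrite !ReImE mulr1 mulr0 subr0; lra.
have /eqP : modC (g (ofR x1) * f (ofR x) + - f (ofR x1) * g (ofR x)) ^+ 2 = 0.
  apply/le_anti; rewrite sqr_ge0 andbT; apply: le_trans H.
  by rewrite /en /energy lerDl sqr_ge0.
rewrite expf_eq0 /= => /eqP /modC_eq0 /eqP.
by rewrite mulNr subr_eq0 => /eqP.
Qed.

End TheEquation.

(** * Growth of Phi_0 at infinity *)

Section Growth.
Context {R : realType}.
Implicit Types (z w c d t : Cx R) (x y : R) (f g : Cx R -> Cx R).

Lemma modC_sum_le (r : seq nat) (P : pred nat) (F : nat -> Cx R) :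
  modC (\sum_(i <- r | P i) F i) <= \sum_(i <- r | P i) modC (F i).
Proof.
elim/big_ind2: _ => [|u x v y hu hv|//]; first by rewrite modC0.
by apply: le_trans (modCD _ _) _; exact: lerD.
Qed.

(** With x = Re t >= 0, a constant multiple of it dominates every correction to the
term of size (2/m) e^(m x / 2) in log |Phi_0|: the factor e^(r t) contributes
linearly in x, and the other terms of S at most e^((m/2 - 1) x). *)
Definition subleading m x : R := 1 + x + expR ((m%:R / 2 - 1) * x).

Lemma half_sub_ofR m k : m%:R / 2 - k%:R = ofR (m%:R / 2 - k%:R : R).
Proof. by rewrite ofRD ofRN ofRM ofR_inv !ofR_nat. Qed.

Lemma Sm_tail_bound m (b : nat -> Cx R) : exists2 K : R, 0 <= K &
  forall t, 0 <= ReC t ->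
    modC (Sm m b t - 2 / m%:R * cpow t (m%:R / 2))
      <= K * expR ((m%:R / 2 - 1) * ReC t).
Proof.
exists (\sum_(1 <= k < m | (k.*2 < m)%N) modC (b k / (m%:R / 2 - k%:R))).
  by apply: sumr_ge0 => k _; exact: modC_ge0.
move=> t t0; rewrite /Sm addrC addKr; apply: le_trans (modC_sum_le _ _ _) _.
rewrite mulr_suml big_nat_cond [leRHS]big_nat_cond.
apply: ler_sum => k /andP[/andP[k1 _] _].
rewrite modCM ler_wpM2l ?modC_ge0 // /cpow modC_expC ler_expR half_sub_ofR.
rewrite ReCM ReCofR ImCofR mul0r subr0 ler_wpM2r // lerD2l lerN2.
by rewrite (ler_nat R 1 k).
Qed.

Lemma leading_factor_bounds m (r : Cx R) (b : nat -> Cx R) : exists2 K : R, 0 <= K &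
  forall t, 0 <= ReC t -> `|ImC t| <= 2 * pi -> exists2 e : R,
    modC (cpow t r * expC (- Sm m b t)) =
      expR (- (2 / m%:R) * ReC (cpow t (m%:R / 2)) + e) &
    `|e| <= K * subleading m (ReC t).
Proof.
have [K K0 HK] := Sm_tail_bound m b.
have pi0 := pi_ge0 R.
exists (modC r * (1 + 2 * pi) + K) => [|t t0 ti].
  by rewrite addr_ge0 // mulr_ge0 ?modC_ge0 //; lra.
set low := Sm m b t - 2 / m%:R * cpow t (m%:R / 2).
exists (ReC (r * t) - ReC low).
  rewrite modCM /cpow !modC_expC -expRD; congr expR.
  have -> : Sm m b t = ofR (2 / m%:R) * expC (m%:R / 2 * t) + low.
    by rewrite /low ofRM ofR_inv !ofR_nat addrC subrK.
  by rewrite ReCN ReCD [ReC (ofR _ * _)]ReCM ReCofR ImCofR; ring.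
have h1 : `|ReC (r * t)| <= modC r * (ReC t + 2 * pi).
  apply: le_trans (ReC_le _) _; rewrite modCM ler_wpM2l ?modC_ge0 //.
  by apply: le_trans (modC_le _) _; rewrite (ger0_norm t0) lerD2l.
have h2 : `|ReC low| <= K * expR ((m%:R / 2 - 1) * ReC t).
  exact: le_trans (ReC_le _) (HK t t0).
apply: le_trans (ler_normB _ _) (le_trans (lerD h1 h2) _).
rewrite /subleading; set E := expR _.
have E0 : 0 <= E := expR_ge0 _.
have r0 := modC_ge0 r.
have p1 : 0 <= K * (1 + ReC t) by apply: mulr_ge0; lra.
have p2 : modC r * (ReC t + 2 * pi) <= modC r * ((1 + 2 * pi) * (1 + ReC t + E)).
  rewrite ler_wpM2l //.
  have : 0 <= pi * (ReC t + E) by apply: mulr_ge0; lra.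
  by lra.
by lra.
Qed.

Lemma near_one_bounds z : modC (z - 1) <= 1 / 2 ->
  expR (-1) <= modC z /\ modC z <= expR 1.
Proof.
move=> h; have e1 := expR_ge1Dx (1 : R).
have u1 : modC z <= modC (z - 1) + 1.
  by have := modCD (z - 1) 1; rewrite subrK modC1.
have u2 : 1 <= modC z + modC (z - 1).
  by have := modCB z (z - 1); rewrite opprB addrCA subrr addr0 modC1.
split; last by lra.
rewrite expRN; have h2 : (expR 1)^-1 <= 2^-1 :> R.
  by rewrite lef_pV2 ?posrE ?expR_gt0 //; lra.
by lra.
Qed.

(** Only the leading term of the asymptotic expansion matters.  The sector
|arg x| <= 2 pi / m contains both the positive axis and its rotation by 1/omega,
and is a strict sub-sector of |arg x| < 3 pi / m. *)
Lemma Phi0_growth n (b : 'rV[Cx R]_n.+1 -> nat -> Cx R)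
    (Phi0 : Cx R -> 'rV[Cx R]_n.+1 -> Cx R) (a : 'rV[Cx R]_n.+1) :
  is_Phi0 b Phi0 -> exists K T0 : R, 0 <= K /\
  forall t, T0 <= ReC t -> `|ImC t| <= 2 * pi / n.+1%:R ->
    let main := - (2 / n.+1%:R) * ReC (cpow t (n.+1%:R / 2)) in
    expR (main - K * subleading n.+1 (ReC t)) <= modC (Phi0 t a) /\
    modC (Phi0 t a) <= expR (main + K * subleading n.+1 (ReC t)).
Proof.
case=> _ [c [c0 asy]] _.
have pi0 := pi_gt0 R.
have m0 : 0 < n.+1%:R :> R by rewrite ltr0n.
have th : 2 * pi / n.+1%:R < 3 * pi / n.+1%:R :> R by rewrite ltr_pM2r ?invr_gt0 //; lra.
have [K1 [X /nbhs_singleton H]] := asy a _ 1%N th.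
have [K K0 HK] := leading_factor_bounds n.+1 (exponent n.+1 (b a)) (b a).
exists (K + 1), (`|X| + 1 + 4 * `|K1|); split=> [|t tT ti]; first by lra.
have X0 := normr_ge0 X; have K10 := normr_ge0 K1; have Xle := ler_norm X.
have t0 : 0 <= ReC t by lra.
have ti' : `|ImC t| <= 2 * pi.
  apply: le_trans ti _; rewrite ler_pdivrMr // ler_peMr ?ler1n //; lra.
have [e eE ele] := HK t t0 ti'.
have Xt : X < ReC t by lra.
have := H t Xt ti; rewrite big_ord1 c0 mul1r mul0r oppr0.
rewrite {2}/cpow mul0r expC0 !normCx -ofRM lecR.
set L := cpow t _ * expC _ in eE *.
set sz := modC (cpow t _).
have step1 : sz <= expR (- (ReC t / 2)).
  rewrite /sz /cpow modC_expC ler_expR mul1r /step.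
  case: ifP => _; last by rewrite mulN1r !ReImE; lra.
  have -> : (1 / 2 : Cx R) = ofR (1 / 2) by rewrite ofRM ofR_inv ofR_nat.
  by rewrite -ofRN !ReImE mul0r subr0; lra.
(* The threshold on Re t was chosen so that K1 e^(- Re t / 2) <= 1/2. *)
move=> asy1.
have small : modC (Phi0 t a / L - 1) <= 1 / 2.
  apply: le_trans asy1 _.
  have sz0 : 0 <= sz := modC_ge0 _.
  apply: le_trans (_ : `|K1| * expR (- (ReC t / 2)) <= _).
    apply: le_trans (_ : `|K1| * sz <= _); first by rewrite ler_wpM2r // ler_norm.
    by rewrite ler_wpM2l.
  rewrite expRN ler_pdivrMr ?expR_gt0 //.
  have := expR_ge1Dx (ReC t / 2); lra.
have L0 : L != 0 by rewrite mulf_neq0 ?expC_neq0.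
have [lo hi] := near_one_bounds small.
have PE : modC (Phi0 t a) = modC (Phi0 t a / L) * modC L by rewrite -modCM mulfVK.
have sub1 : 1 <= subleading n.+1 (ReC t).
  by rewrite /subleading; have := expR_ge0 ((n.+1%:R / 2 - 1) * ReC t); lra.
move: ele; rewrite ler_norml => /andP[el eu].
move=> main; rewrite PE eE; split.
  apply: le_trans (_ : expR (-1) * modC L <= _); rewrite eE.
    rewrite -expRD ler_expR -/main mulrDl mul1r; lra.
  by rewrite ler_wpM2r ?expR_ge0.
apply: le_trans (_ : expR 1 * modC L <= _); rewrite eE.
  by rewrite ler_wpM2r ?expR_ge0.
by rewrite -expRD ler_expR -/main mulrDl mul1r; lra.
Qed.

End Growth.

(** * Linear independence of Phi_(-1) and Phi_0 *)

Section Independence.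
Context {R : realType}.
Implicit Types (z w c d t : Cx R) (x y : R) (f g : Cx R -> Cx R).

(** With v = e^(x/4), the subleading part is at most 6 e^(m x / 2) / v, hence
negligible with respect to the leading one. *)
Lemma leading_term_dominates n (K k x1 : R) : 0 <= K -> 0 <= k ->
  exists x, [/\ x1 <= x, 0 <= x & k <
    expR (4 / n.+1%:R * expR (n.+1%:R / 2 * x) - K * subleading n.+1 x)].
Proof.
move=> K0 k0; set m : R := n.+1%:R.
have m1 : 1 <= m by rewrite ler1n.
have m0 : 0 < m by lra.
pose x := `|x1| + m * (12 * K) + m * k.
have Km : 0 <= m * (12 * K) by rewrite mulr_ge0 // ?mulr_ge0 //; lra.
have km : 0 <= m * k by rewrite mulr_ge0 //; lra.
have a0 := normr_ge0 x1.
have x0 : 0 <= x by rewrite /x; lra.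
exists x; split => //; first by have := ler_norm x1; rewrite /x; lra.
set E := expR (m / 2 * x); set v := expR (x / 4).
have v0 : 0 < v := expR_gt0 _.
have v1 : 1 + x / 4 <= v := expR_ge1Dx _.
have Ev : v ^+ 2 <= E.
  have xm : x <= m * x by rewrite ler_peMl.
  by rewrite -expRM_natl ler_expR; lra.
have sub : v * subleading n.+1 x <= 6 * E.
  rewrite /subleading.
  have dist (u y z : R) : u * (1 + y + z) = u + u * y + u * z by ring.
  rewrite dist.
  have -> : v * expR ((n.+1%:R / 2 - 1) * x) = E * expR (- (3 / 4 * x)).
    by rewrite /v /E -!expRD -/m; congr expR; field.
  have e1 : expR (- (3 / 4 * x)) <= 1 by rewrite -[leRHS]expR0 ler_expR; lra.
  have E0 : 0 <= E := expR_ge0 _.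
  have h1 : E * expR (- (3 / 4 * x)) <= E by rewrite ler_piMr.
  have h2 : v * x <= 4 * v ^+ 2.
    by rewrite expr2 mulrCA; apply: ler_wpM2l; [exact: ltW | lra].
  have h3 : v <= v ^+ 2 by rewrite expr2 ler_peMl ?(ltW v0) //; lra.
  by lra.
have dom : K * subleading n.+1 x <= 2 / m * E.
  rewrite -(ler_pM2l v0); apply: le_trans (_ : K * (6 * E) <= _).
    by rewrite mulrCA; apply: ler_wpM2l.
  have -> : v * (2 / m * E) = (v * 2 / m) * E by ring.
  rewrite mulrA ler_wpM2r ?expR_ge0 // ler_pdivlMr //.
  have : K * 6 * m <= x / 4 * 2 by rewrite /x; lra.
  by lra.
have big : k < 2 / m * E.
  have : m * k / m <= x / m * 1.
    rewrite mulr1 ler_pM2r ?invr_gt0 // /x; lra.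
  rewrite mulr1 [m * k]mulrC mulfK ?gt_eqF // => hk.
  have hE : 1 + x / 2 <= E.
    apply: le_trans (expR_ge1Dx _) _; rewrite ler_expR.
    by have : x <= m * x; [rewrite ler_peMl | lra].
  have m2 : 0 < 2 / m by rewrite divr_gt0.
  have h4 : 2 / m * (1 + x / 2) <= 2 / m * E by rewrite ler_wpM2l // ltW.
  have h5 : 2 / m * (1 + x / 2) = 2 / m + x / m by field; rewrite gt_eqF.
  by rewrite h5 in h4; apply: le_lt_trans hk (lt_le_trans _ h4); rewrite ltrDr.
apply: lt_le_trans (_ : 4 / m * E - K * subleading n.+1 x <= _); last first.
  by apply: le_trans (expR_ge1Dx _); rewrite lerDr.
have -> : 4 / m * E = 2 / m * E + 2 / m * E by field; rewrite gt_eqF.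
apply: lt_le_trans big _.
by rewrite -addrA lerDl subr_ge0.
Qed.

Section Phi.
Variables (n : nat) (b : 'rV[Cx R]_n.+1 -> nat -> Cx R)
  (Phi0 : Cx R -> 'rV[Cx R]_n.+1 -> Cx R).
Hypothesis hPhi0 : is_Phi0 b Phi0.
Implicit Types (a : 'rV[Cx R]_n.+1) (k : int).

Lemma Phi_solves k a : exists f1, solves (potential a) (Phi Phi0 k ^~ a) f1.
Proof.
have [sol _ _] := hPhi0.
have := solves_shift (2 * Ci R * ofR pi * k%:~R / n.+1%:R)
  (is_solution_solves (sol (rescale (omega n.+1 k%:~R) a))).
rewrite (_ : (fun t => potential _ _) = potential a); first by move=> h; eexists; exact: h.
by apply: funext => t; exact: potential_rescale.
Qed.

Lemma Phi_turn k a t : Phi Phi0 (k + n.+1%:Z) t a = Phi Phi0 k (t + turn) a.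
Proof.
have m0 : n.+1%:R != 0 :> Cx R by rewrite pnatr_eq0.
have quot : 2 * Ci R * ofR pi * (k + n.+1%:Z)%:~R / n.+1%:R =
    turn + 2 * Ci R * ofR pi * k%:~R / n.+1%:R.
  rewrite intrD -(pmulrn _ n.+1) /turn; move: m0; move: (n.+1%:R) => m m0.
  by field.
rewrite /Phi /omega quot expCD expC_2pi mul1r; congr Phi0.
by rewrite addrA.
Qed.

(** Along the positive axis Phi_(-1) grows and Phi_0 decays, since turning x by
- 2 pi / m changes the sign of x^(m/2). *)
Lemma Phi_lin_indep a f1 g1 :
  solves (potential a) (Phi Phi0 (-1) ^~ a) f1 ->
  solves (potential a) (Phi Phi0 0 ^~ a) g1 ->
  exists t, wronskian (Phi Phi0 (-1) ^~ a) f1 (Phi Phi0 0 ^~ a) g1 t != 0.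
Proof.
move=> hf hg; apply: contrapT => /forallNP W0.
have [K1 [T1 [K10 H1]]] := Phi0_growth (rescale (omega n.+1 (-1)%:~R) a) hPhi0.
have [K2 [T2 [K20 H2]]] := Phi0_growth (rescale (omega n.+1 0%:~R) a) hPhi0.
have pi0 := pi_ge0 R.
have m0 : 0 < n.+1%:R :> R by rewrite ltr0n.
have m0' : n.+1%:R != 0 :> Cx R by rewrite pnatr_eq0.
have q0 : 0 <= 2 * pi / n.+1%:R :> R by rewrite divr_ge0 ?mulr_ge0 // ltW.
pose E x := expR (n.+1%:R / 2 * x).
have grow x : T1 <= x -> expR (2 / n.+1%:R * E x - K1 * subleading n.+1 x)
    <= modC (Phi Phi0 (-1) (ofR x) a).
  move=> Tx.
  have -> : Phi Phi0 (-1) (ofR x) a =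
    Phi0 (ofR x + ofR (- (2 * pi / n.+1%:R)) * Ci R) (rescale (omega n.+1 (-1)%:~R) a).
    rewrite /Phi; congr Phi0; congr (_ + _).
    by rewrite ofRN !ofRM ofR_inv !ofR_nat mulrN1z; move: m0'; move: (_.+1%:R) => m m0'; field.
  set t := _ + _ * _.
  have Ret : ReC t = x by rewrite /t !ReImE; ring.
  have Imt : ImC t = - (2 * pi / n.+1%:R) by rewrite /t !ReImE; ring.
  have := H1 t; rewrite Ret Imt normrN (ger0_norm q0).
  move=> /(_ Tx (lexx _)) [lo _]; apply: le_trans lo.
  rewrite ler_expR lerD2r.
  have -> : cpow t (n.+1%:R / 2) = - expC (ofR (n.+1%:R / 2 * x)).
    have -> : cpow t (n.+1%:R / 2) = expC (ofR (n.+1%:R / 2 * x) - Ci R * ofR pi).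
      rewrite /cpow /t ofRN !ofRM !ofR_inv !ofR_nat; congr expC.
      by move: m0'; move: (n.+1%:R) => m m0'; field.
    by rewrite expCD expCNV expC_pi invrN1 mulrN1.
  by rewrite ReCN ReC_expC ReCofR ImCofR cos0 mulr1 mulrNN.
have decay x : T2 <= x -> modC (Phi Phi0 0 (ofR x) a) <=
    expR (- (2 / n.+1%:R * E x) + K2 * subleading n.+1 x) /\
    Phi Phi0 0 (ofR x) a != 0.
  move=> Tx.
  have -> : Phi Phi0 0 (ofR x) a = Phi0 (ofR x) (rescale (omega n.+1 0%:~R) a).
    by rewrite /Phi mulr0 mul0r addr0.
  have := H2 (ofR x); rewrite ReCofR ImCofR normr0.
  move=> /(_ Tx q0) [lo hi]; split.
    apply: le_trans hi _; rewrite ler_expR lerD2r.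
    have -> : cpow (ofR x) (n.+1%:R / 2) = expC (ofR (n.+1%:R / 2 * x)).
      by rewrite /cpow !ofRM ofR_inv !ofR_nat.
    by rewrite ReC_expC ReCofR ImCofR cos0 mulr1 mulNr.
  apply: contraTneq lo => ->; rewrite modC0 -ltNge; exact: expR_gt0.
pose x1 := `|T1| + `|T2|.
have x1T1 : T1 <= x1.
  by apply: le_trans (ler_norm _) _; rewrite lerDl.
have x1T2 : T2 <= x1.
  by apply: le_trans (ler_norm _) _; rewrite lerDr.
have /negP/negPn/eqP W1 := W0 (ofR x1).
have prop := proportional_of_wronskian0 hf hg W1 (potential_bounded a).
have [_ g0] := decay x1 x1T2.
move: prop g0; rewrite /=.
move: (Phi Phi0 (-1) (ofR x1) a) (Phi Phi0 0 (ofR x1) a) => F G prop g0.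
have G0 : 0 < modC G.
  by rewrite lt_neqAle modC_ge0 andbT eq_sym; apply: contra g0 => /eqP/modC_eq0 ->.
have [x [xx1 x0]] := leading_term_dominates n x1 (addr_ge0 K10 K20)
  (divr_ge0 (modC_ge0 F) (modC_ge0 G)).
apply/negP; rewrite -leNgt.
have up := grow x (le_trans x1T1 xx1).
have [down _] := decay x (le_trans x1T2 xx1).
have := prop x xx1; rewrite /=; move: up down.
move: (Phi Phi0 (-1) (ofR x) a) (Phi Phi0 0 (ofR x) a) => u v up down uv.
have {}uv : modC G * modC u = modC F * modC v by rewrite -!modCM uv.
rewrite ler_pdivlMr //.
have -> : 4 / n.+1%:R * expR (n.+1%:R / 2 * x) - (K1 + K2) * subleading n.+1 x =
  (2 / n.+1%:R * E x - K1 * subleading n.+1 x) -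
  (- (2 / n.+1%:R * E x) + K2 * subleading n.+1 x).
  by rewrite /E; move: (gt_eqF m0); move: (_.+1%:R) => m m1; field; rewrite m1.
rewrite expRD expRN mulrAC ler_pdivrMr ?expR_gt0 // mulrC.
apply: le_trans (_ : modC G * modC u <= _).
  by rewrite ler_wpM2l ?modC_ge0.
by rewrite uv ler_wpM2l ?modC_ge0.
Qed.

End Phi.
End Independence.

(** * The product of the connection matrices *)

Lemma col2_mulmx (R : realType) (T : 'M[Cx R]_2) (x y x' y' : Cx R) :
  col2 x y = T *m col2 x' y' ->
  x = T 0 0 * x' + T 0 1 * y' /\ y = T 1 0 * x' + T 1 1 * y'.
Proof.
move=> /matrixP h.
have l1 : lift ord0 ord0 = 1 :> 'I_2 by exact: val_inj.
have := h 1 0; have := h 0 0.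
by rewrite !mxE !big_ord_recl !big_ord0 !mxE l1 /= !addr0.
Qed.

Lemma mulmx_chain (R : realType) (S : int -> 'M[Cx R]_2) (v : int -> 'cV[Cx R]_2) :
  (forall k, v k = S k *m v (k + 1)) ->
  forall j : nat, v 0 = (\prod_(k < j) S k%:Z) *m v j%:Z.
Proof.
move=> hv; elim=> [|j IH]; first by rewrite big_ord0 mul1mx.
have -> : j.+1%:Z = j%:Z + 1 by rewrite -[in LHS]addn1 PoszD.
rewrite big_ord_recr IH (hv j%:Z); exact: mulmxA.
Qed.

Lemma connection_prod (R : realType) (m : nat)
    (Phi0 : Cx R -> 'rV[Cx R]_m -> Cx R) (C Ct : int -> 'rV[Cx R]_m -> Cx R) a t
    (j : nat) : is_connection Phi0 C Ct ->
  col2 (Phi Phi0 (0 - 1) t a) (Phi Phi0 0 t a) =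
    (\prod_(k < j) stokes_mx (C k%:Z a) (Ct k%:Z a)) *m
      col2 (Phi Phi0 (j%:Z - 1) t a) (Phi Phi0 j%:Z t a).
Proof.
move=> hC.
apply: (@mulmx_chain R (fun k => stokes_mx (C k a) (Ct k a))
  (fun k => col2 (Phi Phi0 (k - 1) t a) (Phi Phi0 k t a))) => k.
by rewrite addrK; exact: hC.
Qed.

Unset Implicit Arguments.

(* m = n.+1; p is either square root of 1 + 4 a_m. *)
Theorem corollary6p3 (R : realType) (n : nat)
  (b : 'rV[Cx R]_n.+1 -> nat -> Cx R)
  (hb : forall a : 'rV[Cx R]_n.+1, sqrt_expansion a (b a))
  (Phi0 : Cx R -> 'rV[Cx R]_n.+1 -> Cx R)
  (hPhi0 : is_Phi0 b Phi0)
  (C Ct : int -> 'rV[Cx R]_n.+1 -> Cx R)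
  (hC : is_connection Phi0 C Ct)
  (a : 'rV[Cx R]_n.+1) (p : Cx R) (hp : p ^+ 2 = 1 + 4 * a 0 ord_max) :
  \tr (\prod_(k < n.+1) stokes_mx (C k%:Z a) (Ct k%:Z a))
    = - 2 * cosC (ofR pi * p).
Proof.
set T := \prod_(k < n.+1) _.
have [f1 hf] := Phi_solves hPhi0 (-1) a.
have [g1 hg] := Phi_solves hPhi0 0 a.
have conn t : col2 (Phi Phi0 (-1) t a) (Phi Phi0 0 t a) =
    T *m col2 (Phi Phi0 (-1) (t + turn) a) (Phi Phi0 0 (t + turn) a).
  have := connection_prod a t n.+1 hC.
  by rewrite -!Phi_turn !add0r [(-1 + _)%R]addrC.
have T_f t := (col2_mulmx (conn t)).1; have T_g t := (col2_mulmx (conn t)).2.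
have [c hc] := potential_limit a.
pose s : Cx R := (1 + p) / 2.
have s_root : s * (s - 1) = a 0 ord_max.
  have -> : s * (s - 1) = (p ^+ 2 - 1) / 4 by rewrite /s; field.
  by rewrite hp; field.
have := connection_trace hf hg (Phi_lin_indep hPhi0 hf hg)
  T_f T_g (s := s) (c := c).
rewrite s_root => /(_ hc) tr.
have -> : \tr T = T 0 0 + T 1 1.
  rewrite /mxtrace big_ord_recl big_ord1; congr (T 0 0 + T _ _); exact: val_inj.
have sE : s * turn = Ci R * ofR pi + Ci R * (ofR pi * p) by rewrite /s /turn; field.
rewrite tr sE opprD !expCD expC_pi [expC (- (Ci R * ofR pi))]expCNV expC_pi invrN1.
by rewrite /cosC; field.
Qed.
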